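(* For every fixed 45-qubit input state $\rho$ (a density matrix on $(\mathbb{C}^2)^{\otimes 45}$), the map $p\mapsto I_c(\rho,\mathcal{D}_p^{\otimes 45})$ is nonincreasing on $[0,1/4]$.
   Context: The qubit depolarizing channel with per-Pauli error probability $p\in[0,1/3]$ is $\mathcal{D}_p(\rho)=(1-3p)\rho+p(X\rho X+Y\rho Y+Z\rho Z)$, with $X,Y,Z$ the Pauli matrices. Entropies are in bits: $S(\rho)=-\mathrm{Tr}(\rho\log_2\rho)$. For a channel $\mathcal{N}$ and an input state $\rho$ with purification $\psi_\rho$, the coherent information is $I_c(\rho,\mathcal{N})=S(\mathcal{N}(\rho))-S((\mathrm{id}\otimes\mathcal{N})(\psi_\rho))$ (where $\mathrm{id}$ acts on the purifying system). *)

(* Defs.v *)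
From mathcomp Require Import all_boot all_order all_algebra.
From mathcomp Require Import spectral.
From mathcomp Require Import complex mxtens.
From mathcomp Require Import reals numfun exp.

Set Implicit Arguments.
Unset Strict Implicit.
Unset Printing Implicit Defensive.

Import Order.TTheory GRing.Theory Num.Theory.
Local Open Scope ring_scope.
Local Open Scope complex_scope.
Local Open Scope sesquilinear_scope.

(* Composite systems: C^m (x) C^n is C^(m * n), with basis vectors indexed
   through [mxtens_index] exactly as in the Kronecker product [tensmx]. *)

Section States.
Variable R : realType.
Local Notation C := R[i].

Definition psdmx n (A : 'M[C]_n) : Prop :=
  A \is hermsymmx /\ forall v : 'cV[C]_n, 0 <= (v ^t* *m A *m v) 0 0.

Definition density n (rho : 'M[C]_n) : Prop := psdmx rho /\ \tr rho = 1.

Definition ptrace1 m n (M : 'M[C]_(m * n)) : 'M[C]_n :=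
  \matrix_(i, j) \sum_(a < m) M (mxtens_index (a, i)) (mxtens_index (a, j)).

Definition pure_state n (psi : 'cV[C]_n) : 'M[C]_n := psi *m psi ^t*.

(* The purifying system is the first tensor factor, of arbitrary dimension k. *)
Definition purifies k n (psi : 'cV[C]_(k * n)) (rho : 'M[C]_n) : Prop :=
  ptrace1 (pure_state psi) = rho.

(* [ln] is 0 on nonpositive reals, which gives the convention 0 log2 0 = 0
   in [vn_entropy]. *)
Definition log2 (x : R) : R := ln x / ln 2.

(* Functional calculus. Meaningful for Hermitian A, which equals
   (spectralmx A)^t* *m diag_mx (spectral_diag A) *m spectralmx A,
   with [spectralmx A] unitary and [spectral_diag A] real. *)
Definition mxfun (f : R -> R) n (A : 'M[C]_n) : 'M[C]_n :=
  (spectralmx A) ^t*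
    *m diag_mx (map_mx (fun z => (f (complex.Re z))%:C) (spectral_diag A))
    *m spectralmx A.

Definition vn_entropy n (rho : 'M[C]_n) : R :=
  - complex.Re (\tr (rho *m mxfun log2 rho)).

End States.

Section Channels.
Variable R : realType.
Local Notation C := R[i].

(* For linear Phi and Psi, this is the linear map sending A *t B to
   Phi A *t Psi B: the argument M is expanded in the products
   delta_mx i j *t delta_mx k l of matrix units. *)
Definition tensmap m n (Phi : 'M[C]_m -> 'M[C]_m) (Psi : 'M[C]_n -> 'M[C]_n)
    (M : 'M[C]_(m * n)) : 'M[C]_(m * n) :=
  \sum_(i < m) \sum_(j < m) \sum_(k < n) \sum_(l < n)
    M (mxtens_index (i, k)) (mxtens_index (j, l))
      *: tensmx (Phi (delta_mx i j)) (Psi (delta_mx k l)).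

(* As for [ntensmx], starting the recursion at exponent 1 avoids casts:
   m ^ 1 and m ^ n.+2 are convertible to m and m * m ^ n.+1. *)
Fixpoint ntensmap_rec m (Phi : 'M[C]_m -> 'M[C]_m) n :
    'M[C]_(m ^ n.+1) -> 'M[C]_(m ^ n.+1) :=
  match n return 'M[C]_(m ^ n.+1) -> 'M[C]_(m ^ n.+1) with
  | 0 => Phi
  | n'.+1 => tensmap Phi (@ntensmap_rec m Phi n')
  end.
Arguments ntensmap_rec {m} Phi n.

Definition ntensmap m (Phi : 'M[C]_m -> 'M[C]_m) n :
    'M[C]_(m ^ n) -> 'M[C]_(m ^ n) :=
  match n return 'M[C]_(m ^ n) -> 'M[C]_(m ^ n) with
  | 0 => idfun
  | n'.+1 => ntensmap_rec Phi n'
  end.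

Definition pauliX : 'M[C]_2 := delta_mx 0 1 + delta_mx 1 0.
Definition pauliY : 'M[C]_2 := - 'i *: delta_mx 0 1 + 'i *: delta_mx 1 0.
Definition pauliZ : 'M[C]_2 := delta_mx 0 0 - delta_mx 1 1.

Definition depolarizing (p : R) (rho : 'M[C]_2) : 'M[C]_2 :=
  (1 - 3 * p)%:C *: rho
  + p%:C *: (pauliX *m rho *m pauliX + pauliY *m rho *m pauliY
             + pauliZ *m rho *m pauliZ).

(* [psi] is meant to be a purification of [rho]; for a
   channel [Phi] the value does not depend on which one. *)
Definition coherent_info k n (rho : 'M[C]_n) (psi : 'cV[C]_(k * n))
    (Phi : 'M[C]_n -> 'M[C]_n) : R :=
  vn_entropy (Phi rho) - vn_entropy (tensmap idfun Phi (pure_state psi)).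

End Channels.

Arguments ntensmap_rec {R m} Phi n.
Arguments ntensmap {R m} Phi n.

(* Main.v *)
(* Since D_p' = D_q o D_p for p <= p' <= 1/4 and a suitable q in [0, 1/4], and
   D_q^(x)n is a mixture of unitary conjugations, it suffices to show that
   S(w_B) - S(w) decreases under mixtures of local unitaries on B.  Up to the
   factor ln 2 this number is the relative entropy of w and sig = 1 (x) w_B,
     sum_ij c_ij l_i (ln l_i - ln m_j),
   where l and m are the spectra of w and sig and c_ij the squared overlaps of
   the eigenvectors.  It equals
     int_0^1 (sum_ij c_ij l_i^2 / ((1 - s) l_i + s m_j) - tr w) ds / s,
   and for each s the sum is the maximum over all matrices Y of
     Re tr (2 w Y - (1 - s) w Y Y^* - s sig Y^* Y).
   The latter is linear in (w, sig), and conjugating w and sig by a unitary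
   amounts to conjugating Y, so the maximum decreases under mixtures of unitary
   conjugations.  The integral over s is replaced by a monotonicity argument. *)

Require Import Defs.
From mathcomp Require Import all_boot all_order all_algebra.
From mathcomp Require Import spectral.
From mathcomp Require Import complex mxtens.
From mathcomp Require Import reals numfun.
From mathcomp Require Import boolp normedtype.
From mathcomp Require Import derive realfun exp.
From mathcomp Require Import ring lra.
Set Implicit Arguments.
Unset Strict Implicit.
Unset Printing Implicit Defensive.
Import Order.TTheory GRing.Theory Num.Theory.
Import numFieldNormedType.Exports.
Local Open Scope ring_scope.
Local Open Scope complex_scope.
Local Open Scope sesquilinear_scope.

(** * A logarithmic inequality from monotonicity in the interpolation parameter *)

Section LogIntegral.
Variable R : realType.

Lemma is_derive_bigsum (J : Type) (r : seq J) (f : J -> R -> R)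
    (df : J -> R) (s : R) :
  (forall j, is_derive s 1 (f j) (df j)) ->
  is_derive s 1 (fun t => \sum_(j <- r) f j t) (\sum_(j <- r) df j).
Proof.
move=> fdf; elim: r => [|j r IH].
  under eq_fun do rewrite big_nil.
  by rewrite big_nil; exact: is_derive_cst.
under eq_fun do rewrite big_cons.
by rewrite big_cons; exact: is_deriveD.
Qed.

Lemma segment_gt0 (x y s : R) : 0 < x -> 0 < y -> 0 <= s <= 1 ->
  0 < (1 - s) * x + s * y.
Proof. by move=> x0 y0 /andP[s0 s1]; nra. Qed.

(* Since [\sum_j e j = 0], the sum over [e j * (x j / _)] is [s] times the
   derivative of [- \sum_j e j * ln ((1 - s) * x j + s * y j)], whose increment
   between [s = 0] and [s = 1] is the sum to be bounded. *)
Lemma log_sum_ge0 (J : finType) (e x y : J -> R) :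
  (forall j, e j != 0 -> 0 < x j /\ 0 < y j) -> \sum_j e j = 0 ->
  (forall s : R, 0 < s < 1 ->
    0 <= \sum_j e j * (x j / ((1 - s) * x j + s * y j))) ->
  0 <= \sum_j e j * (ln (x j) - ln (y j)).
Proof.
move=> xy0 e0 ge0.
pose h (s : R) := \sum_j e j * - ln ((1 - s) * x j + s * y j).
pose dh (s : R) := \sum_j e j * ((x j - y j) / ((1 - s) * x j + s * y j)).
have hdh (s : R) : 0 <= s <= 1 -> is_derive s 1 h (dh s).
  move=> s01; apply: is_derive_bigsum => j.
  (* Where [e j = 0] the logarithm may have a nonpositive argument, but the term is constantly 0. *)
  have [->|ej] := eqVneq (e j) 0.
    rewrite mul0r; under eq_fun do rewrite mul0r.
    exact: is_derive_cst.
  have [xj yj] := xy0 _ ej.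
  have D0 := segment_gt0 xj yj s01.
  have dln := is_derive1_ln D0.
  have dlin : is_derive s 1 (fun t : R => (1 - t) * x j + t * y j) (y j - x j).
    apply: is_derive_eq.
    by rewrite -![_ *: _]/(_ * _); ring.
  have dcomp := @is_derive1_comp _ (@ln R) _ s _ _ dln dlin.
  have d := is_deriveZ (e j) (is_deriveN dcomp).
  have -> : e j * ((x j - y j) / ((1 - s) * x j + s * y j)) =
      e j *: - (((1 - s) * x j + s * y j)^-1 * (y j - x j)).
    by rewrite -[RHS]/(_ * _) -mulrN opprB [in RHS]mulrC; ring.
  exact: d.
have h01 : h 0 <= h 1.
  have hle := @ger0_derive1_le_cc _ h 0 1 _ _ _.
  apply: hle; rewrite ?in_itv /= ?lexx ?ler01 //.
  - move=> s; rewrite in_itv /= => /andP[s0 s1].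
    by have [] := hdh s _; rewrite ?ltW.
  - move=> s; rewrite in_itv /= => /andP[s0 s1].
    have s01 : 0 <= s <= 1 by rewrite !ltW.
    have [_ ] := hdh s s01; rewrite derive1E => ->.
    (* This is [s * (x - y) = x - ((1 - s) * x + s * y)], divided by [s] and by the denominator. *)
    have -> : dh s = s^-1 *
        (\sum_j e j * (x j / ((1 - s) * x j + s * y j)) - \sum_j e j).
      rewrite -sumrB mulr_sumr.
      apply: eq_bigr => j _.
      have [->|ej] := eqVneq (e j) 0; first by rewrite !(mul0r, subr0, mulr0).
      have [xj yj] := xy0 _ ej.
      have := gt_eqF (segment_gt0 xj yj s01).
      by move=> D0; field; rewrite D0 gt_eqF.
    by rewrite e0 subr0 mulr_ge0 ?invr_ge0 ?(ltW s0) // ge0 // s0.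
  apply: derivable_within_continuous => s; rewrite in_itv /= => s01.
  by have [] := hdh s s01.
rewrite -subr_ge0 /h -sumrB in h01.
apply: le_trans h01 _; apply: ler_sum => j _.
by rewrite subrr subr0 !mul0r !mul1r add0r addr0 -mulrBr opprK addrC.
Qed.
End LogIntegral.

(** * Real parts, squared moduli and spectral decompositions *)

Section Spectral.
Variable R : realType.
Local Notation C := R[i].
Local Notation Re := (@complex.Re R).
Local Notation Im := (@complex.Im R).

Lemma ReD (z w : C) : Re (z + w) = Re z + Re w.
Proof. by case: z; case: w. Qed.

Lemma Re_sum (J : Type) (r : seq J) (P : pred J) (F : J -> C) :
  Re (\sum_(j <- r | P j) F j) = \sum_(j <- r | P j) Re (F j).
Proof. exact: (big_morph Re ReD). Qed.

Lemma ReZ (a : R) (z : C) : Re (a%:C * z) = a * Re z.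
Proof. by case: z => x y /=; rewrite mul0r subr0. Qed.

Definition sqnorm (z : C) : R := Re z ^+ 2 + Im z ^+ 2.

Lemma mulzJ (z : C) : z * z^* = (sqnorm z)%:C.
Proof.
case: z => x y; apply/eqP; rewrite eq_complex /sqnorm /=.
by apply/andP; split; apply/eqP; ring.
Qed.

Lemma sqnorm_ge0 (z : C) : 0 <= sqnorm z.
Proof. by rewrite addr_ge0 ?sqr_ge0. Qed.

Definition rdiag n (l : 'I_n -> R) : 'M[C]_n := diag_mx (\row_i (l i)%:C).

Lemma rdiagM n (l m : 'I_n -> R) :
  rdiag l *m rdiag m = rdiag (fun i => l i * m i).
Proof.
rewrite /rdiag mulmx_diag; congr diag_mx.
by apply/rowP => i; rewrite !mxE rmorphM.
Qed.

Lemma tr_rdiagM n (l : 'I_n -> R) (A : 'M[C]_n) :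
  Re (\tr (rdiag l *m A)) = \sum_i l i * Re (A i i).
Proof.
rewrite Re_sum; apply: eq_bigr => i _.
by rewrite mul_diag_mx !mxE ReZ.
Qed.

Lemma tr_rdiag n (l : 'I_n -> R) : Re (\tr (rdiag l)) = \sum_i l i.
Proof.
rewrite -[rdiag l]mulmx1 tr_rdiagM; apply: eq_bigr => i _.
by rewrite mxE eqxx mulr1.
Qed.

Lemma unitarymx1 n : (1%:M : 'M[C]_n) \is unitarymx.
Proof. by apply/unitarymxP; rewrite trmx1 map_mx1 mulmx1. Qed.

Lemma unitarymxPl m (U : 'M[C]_m) : U \is unitarymx -> U ^t* *m U = 1%:M.
Proof. by move/unitarymxP/mulmx1C. Qed.

(* The eigenvectors are the columns of [U ^t*]. *)
Definition diagonalizes n (U : 'M[C]_n) (l : 'I_n -> R) (A : 'M[C]_n) :=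
  [/\ U \is unitarymx, forall i, 0 <= l i & A = U ^t* *m rdiag l *m U].

Lemma diagonalizesE n (U : 'M[C]_n) l A : diagonalizes U l A ->
  U *m A *m U ^t* = rdiag l.
Proof.
case=> /unitarymxP UU _ ->; rewrite !mulmxA UU mul1mx.
by rewrite -mulmxA UU mulmx1.
Qed.

Lemma conj_diag n (U A : 'M[C]_n) i (v := col i (U ^t*)) :
  (U *m A *m U ^t*) i i = (v ^t* *m A *m v) 0 0.
Proof.
rewrite !mxE; apply: eq_bigr => j _; rewrite !mxE; congr (_ * _).
by apply: eq_bigr => k _; rewrite !mxE conjCK.
Qed.

(** The entropy formula comes with the decomposition because [vn_entropy] is computed in the
    eigenbasis [spectralmx A]; its independence of the eigenbasis then never has to be shown. *)
Lemma psd_diagonalizes n (A : 'M[C]_n) : psdmx A ->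
  exists U l, diagonalizes U l A /\
    vn_entropy A = - \sum_i l i * log2 (l i).
Proof.
move=> [Ah A0]; pose U := spectralmx A.
pose l i := Re (spectral_diag A 0 i).
have Uu : U \is unitarymx by exact: spectral_unitarymx.
have /unitarymxP UU := Uu.
have lE : diag_mx (spectral_diag A) = rdiag l.
  congr diag_mx; apply/rowP => i; rewrite mxE RRe_real //.
  by move/mxOverP: (hermitian_spectral_diag_real Ah); apply.
have AE : A = U ^t* *m rdiag l *m U.
  have /orthomx_spectralP := hermitian_normalmx Ah.
  by rewrite invmx_unitary // lE.
exists U, l; split; last first.
  rewrite /vn_entropy /mxfun -/U; congr (- _).
  have -> : diag_mx (map_mx (fun z => (log2 (Re z))%:C) (spectral_diag A)) =
      rdiag (fun i => log2 (l i)).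
    by congr diag_mx; apply/rowP => i; rewrite !mxE.
  rewrite [X in X *m _]AE -!mulmxA mxtrace_mulC !mulmxA -!mulmxA UU mulmx1.
  by rewrite (mulmxA U) UU mul1mx rdiagM tr_rdiag.
split=> // i.
have: 0 <= (U *m A *m U ^t*) i i by rewrite conj_diag.
rewrite AE !mulmxA UU mul1mx -mulmxA UU mulmx1.
by rewrite !mxE eqxx mulr1n ler0c.
Qed.

Lemma mulmxJE n (A B : 'M[C]_n) i : (A *m B ^t*) i i = \sum_j A i j * (B i j)^*.
Proof. by rewrite mxE; apply: eq_bigr => j _; rewrite !mxE. Qed.

Lemma tr_rdiagMJ n (l : 'I_n -> R) (A B : 'M[C]_n) :
  Re (\tr (rdiag l *m (A *m B ^t*))) =
  \sum_i \sum_j l i * Re (A i j * (B i j)^*).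
Proof.
rewrite tr_rdiagM; apply: eq_bigr => i _.
by rewrite mulmxJE Re_sum mulr_sumr.
Qed.

(** * The variational functional and its maximum *)

Definition gain n (s : R) (w sig Y : 'M[C]_n) : R :=
  2 * Re (\tr (w *m Y)) - (1 - s) * Re (\tr (w *m (Y *m Y ^t*)))
  - s * Re (\tr (sig *m (Y ^t* *m Y))).

Lemma Re_tr_sumZ (I : finType) n (p : I -> R) (A : I -> 'M[C]_n) B :
  Re (\tr ((\sum_i (p i)%:C *: A i) *m B)) = \sum_i p i * Re (\tr (A i *m B)).
Proof.
rewrite mulmx_suml (raddf_sum (@mxtrace _ n)) Re_sum; apply: eq_bigr => i _.
by rewrite -scalemxAl /= mxtraceZ ReZ.
Qed.

Lemma gain_sum (I : finType) n s (p : I -> R) (w sig : I -> 'M[C]_n) Y :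
  gain s (\sum_i (p i)%:C *: w i) (\sum_i (p i)%:C *: sig i) Y =
  \sum_i p i * gain s (w i) (sig i) Y.
Proof.
rewrite /gain !Re_tr_sumZ !mulr_sumr -!sumrB.
by apply: eq_bigr => i _; ring.
Qed.

Lemma gain_conj n s (V w sig Y : 'M[C]_n) : V \is unitarymx ->
  gain s (V *m w *m V ^t*) (V *m sig *m V ^t*) Y =
  gain s w sig (V ^t* *m Y *m V).
Proof.
move=> /unitarymxP VV.
have trE (A B : 'M[C]_n) :
    \tr (V *m A *m V ^t* *m B) = \tr (A *m (V ^t* *m B *m V)).
  by rewrite -!mulmxA mxtrace_mulC !mulmxA.
rewrite /gain !trE !(trmx_mul, map_mxM) /= !trmxCK.
by rewrite -!mulmxA !(mulmxA V (V ^t*)) VV !mul1mx.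
Qed.

(** Taking rows of [Y] in the eigenbasis of [w] and columns in that of [sig] decouples the
    functional: each entry of [Z] occurs in a scalar quadratic of its own. *)
Lemma gainE n s (U W : 'M[C]_n) l m w sig Y (Z := U *m Y *m W ^t*)
    (K := U *m W ^t*) : diagonalizes U l w -> diagonalizes W m sig ->
  gain s w sig Y = \sum_i \sum_j
    (2 * (l i * Re (Z i j * (K i j)^*))
     - ((1 - s) * l i + s * m j) * sqnorm (Z i j)).
Proof.
move=> [Uu _ ->] [Wu _ ->].
have WW := unitarymxPl Wu; have UU := unitarymxPl Uu.
have trE (V A B : 'M[C]_n) :
    \tr (V ^t* *m A *m V *m B) = \tr (A *m (V *m B *m V ^t*)).
  by rewrite -!mulmxA mxtrace_mulC !mulmxA.
rewrite /gain !trE.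
have -> : U *m Y *m U ^t* = Z *m K ^t*.
  rewrite /Z /K trmx_mul map_mxM trmxCK.
  by rewrite -!mulmxA (mulmxA (W ^t*) W) WW mul1mx.
have -> : U *m (Y *m Y ^t*) *m U ^t* = Z *m Z ^t*.
  rewrite /Z !(trmx_mul, map_mxM) /= trmxCK.
  by rewrite -!mulmxA (mulmxA (W ^t*) W) WW mul1mx.
have -> : W *m (Y ^t* *m Y) *m W ^t* = Z ^t* *m (Z ^t*) ^t*.
  rewrite trmxCK /Z !(trmx_mul, map_mxM) /= trmxCK.
  by rewrite -!mulmxA (mulmxA (U ^t*) U) UU mul1mx.
rewrite [X in 2 * X]tr_rdiagMJ [X in _ - (1 - s) * X]tr_rdiagMJ.
rewrite [X in _ - s * X]tr_rdiagMJ.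
rewrite [X in _ - s * X]exchange_big /= !mulr_sumr -!sumrB.
apply: eq_bigr => i _; rewrite !mulr_sumr -!sumrB; apply: eq_bigr => j _.
have -> : (Z ^t*) j i = (Z i j)^* by rewrite mxE mxE.
by rewrite conjCK [(Z i j)^* * _]mulrC !mulzJ /=; ring.
Qed.

(* The maximum over [Y] of [gain s w sig Y]; a zero denominator comes with a
   zero numerator, and the quotient is then 0 as it should. *)
Definition quad_overlap n s (K : 'M[C]_n) (l m : 'I_n -> R) : R :=
  \sum_i \sum_j sqnorm (K i j) * (l i ^+ 2 / ((1 - s) * l i + s * m j)).

(** Completing the square: multiplied by [d], the gap is the squared modulus of [a k - d z]. For
    [d = 0] both sides are 0. *)
Lemma quad_bound (a d : R) (z k : C) : 0 <= d -> (d = 0 -> a = 0) ->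
  2 * (a * Re (z * k^*)) - d * sqnorm z <= sqnorm k * (a ^+ 2 / d).
Proof.
case: z k => x y [u v] d0 da; rewrite /sqnorm /=.
have [dE|dN] := eqVneq d 0; first by rewrite dE da //; lra.
have dgt : 0 < d by rewrite lt0r dN.
rewrite [leRHS]mulrA ler_pdivlMr // -subr_ge0.
have -> : (u ^+ 2 + v ^+ 2) * a ^+ 2 -
    (2 * (a * (x * u - y * - v)) - d * (x ^+ 2 + y ^+ 2)) * d =
    (a * u - d * x) ^+ 2 + (a * v - d * y) ^+ 2 by ring.
by rewrite addr_ge0 ?sqr_ge0.
Qed.

(** This [z] makes the completed square of [quad_bound] vanish. *)
Lemma quad_attained (a d : R) (k : C) (z := (a / d)%:C * k) :
  (d = 0 -> a = 0) ->
  2 * (a * Re (z * k^*)) - d * sqnorm z = sqnorm k * (a ^+ 2 / d).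
Proof.
rewrite {}/z; case: k => u v da; rewrite /sqnorm /=.
have [dE|dN] := eqVneq d 0; first by rewrite dE da //; ring.
by field.
Qed.

Lemma segment_ge0 (x y s : R) : 0 <= x -> 0 <= y -> 0 < s < 1 ->
  0 <= (1 - s) * x + s * y.
Proof. by move=> x0 y0 /andP[s0 s1]; nra. Qed.

Lemma segment_eq0 (x y s : R) : 0 <= x -> 0 <= y -> 0 < s < 1 ->
  (1 - s) * x + s * y = 0 -> x = 0.
Proof. by move=> x0 y0 /andP[s0 s1] e; nra. Qed.

Lemma gain_le n s (U W : 'M[C]_n) l m w sig Y : 0 < s < 1 ->
  diagonalizes U l w -> diagonalizes W m sig ->
  gain s w sig Y <= quad_overlap s (U *m W ^t*) l m.
Proof.
move=> s01 dw dsig; rewrite (gainE _ _ dw dsig).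
have [_ l0 _] := dw; have [_ m0 _] := dsig.
apply: ler_sum => i _; apply: ler_sum => j _; apply: quad_bound.
  exact: segment_ge0.
exact: segment_eq0.
Qed.

Lemma gain_attained n s (U W : 'M[C]_n) l m w sig : 0 < s < 1 ->
  diagonalizes U l w -> diagonalizes W m sig ->
  exists Y, gain s w sig Y = quad_overlap s (U *m W ^t*) l m.
Proof.
move=> s01 dw dsig; have [Uu l0 _] := dw; have [Wu m0 _] := dsig.
pose K := U *m W ^t*.
(* The entrywise maximisers of [quad_attained], written in the two eigenbases. *)
pose Z := \matrix_(i, j) ((l i / ((1 - s) * l i + s * m j))%:C * K i j).
exists (U ^t* *m Z *m W); rewrite (gainE _ _ dw dsig).
apply: eq_bigr => i _; apply: eq_bigr => j _.
have -> : U *m (U ^t* *m Z *m W) *m W ^t* = Z.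
  rewrite !mulmxA (unitarymxP Uu) mul1mx -mulmxA (unitarymxP Wu).
  by rewrite mulmx1.
by rewrite mxE quad_attained //; exact: segment_eq0.
Qed.

(* [ln 0 = 0], so this is the relative entropy only under [supports K l m]. *)
Definition rel_entropy n (K : 'M[C]_n) (l m : 'I_n -> R) : R :=
  \sum_i \sum_j sqnorm (K i j) * l i * (ln (l i) - ln (m j)).

(** * Monotonicity of the relative entropy under mixtures of unitary conjugations *)

Lemma sum_sqnorm_row n (K : 'M[C]_n) i : K \is unitarymx ->
  \sum_j sqnorm (K i j) = 1.
Proof.
move=> /unitarymxP /(congr1 (fun A : 'M_n => Re (A i i))).
rewrite mulmxJE Re_sum mxE eqxx /= => <-.
by apply: eq_bigr => j _; rewrite mulzJ.
Qed.

Lemma overlap_unitary n (U W : 'M[C]_n) : U \is unitarymx -> W \is unitarymx ->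
  U *m W ^t* \is unitarymx.
Proof.
move=> Uu Wu; have Wt : W ^t* \is unitarymx by rewrite trmxC_unitary.
exact: mul_unitarymx Uu Wt.
Qed.

Lemma diagonalizes_tr n (U : 'M[C]_n) l A : diagonalizes U l A ->
  Re (\tr A) = \sum_i l i.
Proof.
move=> [/unitarymxP UU _ ->].
by rewrite -mulmxA mxtrace_mulC -mulmxA UU mulmx1 tr_rdiag.
Qed.

(** Inclusion of the support of [w] in that of [sig], in terms of spectra and overlaps. It keeps
    [ln 0 = 0] from entering [rel_entropy] with a nonzero weight. *)
Definition supports n (K : 'M[C]_n) (l m : 'I_n -> R) :=
  forall i j, m j = 0 -> sqnorm (K i j) * l i = 0.

Lemma rel_entropy_mixed_unitary (I : finType) n (p : I -> R) (V : I -> 'M[C]_n)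
    (w sig U W U' W' : 'M[C]_n) l m l' m' :
  (forall i, 0 <= p i) -> \sum_i p i = 1 -> (forall i, V i \is unitarymx) ->
  diagonalizes U l w -> diagonalizes W m sig ->
  diagonalizes U' l' (\sum_i (p i)%:C *: (V i *m w *m (V i) ^t*)) ->
  diagonalizes W' m' (\sum_i (p i)%:C *: (V i *m sig *m (V i) ^t*)) ->
  supports (U *m W ^t*) l m -> supports (U' *m W' ^t*) l' m' ->
  rel_entropy (U' *m W' ^t*) l' m' <= rel_entropy (U *m W ^t*) l m.
Proof.
move=> p0 p1 Vu dw ds dw' ds' supp supp'.
have [Uu l0 _] := dw; have [Wu m0 _] := ds.
have [Uu' l0' _] := dw'; have [Wu' m0' _] := ds'.
set K := U *m W ^t*; set K' := U' *m W' ^t*.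
(* A [Y] optimal for the mixed pair has as its gain an average of gains of [(w, sig)] at conjugates
   of [Y], each bounded by the maximum for [(w, sig)]. *)
have overlap_le s : 0 < s < 1 ->
    quad_overlap s K' l' m' <= quad_overlap s K l m.
  move=> s01; have [Y <-] := gain_attained s01 dw' ds'.
  rewrite gain_sum -[leRHS]mul1r -p1 mulr_suml; apply: ler_sum => i _.
  apply: (ler_wpM2l (p0 i)); rewrite (gain_conj _ _ _ _ (Vu i)).
  exact: gain_le s01 dw ds.
have tr_eq : \sum_i l i = \sum_i l' i.
  rewrite -(diagonalizes_tr dw) -(diagonalizes_tr dw').
  rewrite (raddf_sum (@mxtrace _ n)) [RHS]Re_sum /= -[LHS]mul1r -p1 mulr_suml.
  apply: eq_bigr => i _; rewrite mxtraceZ ReZ; congr (_ * Re _).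
  by rewrite -mulmxA mxtrace_mulC -mulmxA (unitarymxPl (Vu i)) mulmx1.
have sumK (k : 'M[C]_n) (f : 'I_n -> R) : k \is unitarymx ->
    \sum_i \sum_j sqnorm (k i j) * f i = \sum_i f i.
  move=> ku; apply: eq_bigr => i _.
  by rewrite -mulr_suml sum_sqnorm_row // mul1r.
(* Signed weights on a disjoint union, positive for the original pair and negative for the mixed
   one, put both relative entropies into one sum. The total weight is 0 because the traces agree. *)
pose e (x : ('I_n * 'I_n) + ('I_n * 'I_n)) := match x with
  | inl ij => sqnorm (K ij.1 ij.2) * l ij.1
  | inr ij => - (sqnorm (K' ij.1 ij.2) * l' ij.1) end.
pose X (x : ('I_n * 'I_n) + ('I_n * 'I_n)) := match x with
  | inl ij => l ij.1 | inr ij => l' ij.1 end.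
pose Y (x : ('I_n * 'I_n) + ('I_n * 'I_n)) := match x with
  | inl ij => m ij.2 | inr ij => m' ij.2 end.
rewrite -subr_ge0.
have -> : rel_entropy K l m - rel_entropy K' l' m' =
    \sum_x e x * (ln (X x) - ln (Y x)).
  rewrite /rel_entropy !pair_bigA big_sumType /= -sumrN.
  by congr (_ + _); apply: eq_bigr => ij _; rewrite mulNr.
apply: log_sum_ge0.
- move=> [[i j]|[i j]] /=; rewrite ?oppr_eq0 => ne0.
    split; rewrite lt0r ?l0 ?m0 andbT; apply: contraNneq ne0.
      by move=> ->; rewrite mulr0.
    by move=> /supp ->.
  split; rewrite lt0r ?l0' ?m0' andbT; apply: contraNneq ne0.
    by move=> ->; rewrite mulr0.
  by move=> /supp' ->.
- rewrite big_sumType /= sumrN -!(pair_bigA _ (fun i j => sqnorm (_ i j) * _ i)) /=.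
  by rewrite !sumK ?overlap_unitary // tr_eq subrr.
move=> s s01.
have -> : \sum_x e x * (X x / ((1 - s) * X x + s * Y x)) =
    quad_overlap s K l m - quad_overlap s K' l' m'.
  rewrite /quad_overlap !pair_bigA big_sumType /= -sumrN.
  congr (_ + _); apply: eq_bigr => ij _; first by rewrite expr2 !mulrA.
  by rewrite expr2 mulNr !mulrA.
by rewrite subr_ge0; exact: overlap_le.
Qed.
End Spectral.

(** * Tensor products of matrices and of linear maps, and the partial trace *)

Section Tensor.
Variable R : realType.
Local Notation C := R[i].

Section LinearMaps.
Variables (V W : lmodType C) (f : V -> W).
Hypothesis lf : linear f.

Lemma linear_0 : f 0 = 0.
Proof. by have := lf (-1) 0 0; rewrite !scaleN1r oppr0 addr0 addNr. Qed.

Lemma linear_Z a u : f (a *: u) = a *: f u.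
Proof. by rewrite -[a *: u]addr0 lf linear_0 addr0. Qed.

Lemma linear_bigsum (I : Type) (r : seq I) (F : I -> V) :
  f (\sum_(i <- r) F i) = \sum_(i <- r) f (F i).
Proof.
apply: (big_morph f _ linear_0) => u v.
by rewrite -[u]scale1r lf !scale1r.
Qed.
End LinearMaps.

Lemma linear_comp (U V W : lmodType C) (f : V -> W) (g : U -> V) :
  linear f -> linear g -> linear (f \o g).
Proof. by move=> lf lg a u v /=; rewrite lg lf. Qed.

Lemma tensmxl_linear m n p q (B : 'M[C]_(p, q)) :
  linear (fun A : 'M[C]_(m, n) => A *t B).
Proof. by move=> a u v; apply/matrixP => i j; rewrite !mxE mulrDl mulrA. Qed.

Lemma tensmxr_linear m n p q (A : 'M[C]_(m, n)) :
  linear (fun B : 'M[C]_(p, q) => A *t B).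
Proof. by move=> a u v; apply/matrixP => i j; rewrite !mxE mulrDr mulrCA. Qed.

Lemma tensmx11 m n : (1%:M : 'M[C]_m) *t (1%:M : 'M[C]_n) = 1%:M.
Proof.
apply/matrixP => i j; case: (mxtens_indexP i) => i1 i2.
case: (mxtens_indexP j) => j1 j2; rewrite tensmxE !mxE -natrM mulnb.
by rewrite (can_eq (@mxtens_indexK m n)) xpair_eqE.
Qed.

Lemma tensmx_conj m n p q (A : 'M[C]_(m, n)) (B : 'M[C]_(p, q)) :
  (A *t B) ^t* = A ^t* *t B ^t*.
Proof. by rewrite trmx_tens map_mxT. Qed.

Lemma tensmx_unitary m n (A : 'M[C]_m) (B : 'M[C]_n) :
  A \is unitarymx -> B \is unitarymx -> A *t B \is unitarymx.
Proof.
move=> /unitarymxP AA /unitarymxP BB; apply/unitarymxP.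
by rewrite tensmx_conj tensmx_mul AA BB tensmx11.
Qed.

Lemma sum_mxtens_index m n (V : nmodType) (F : 'I_(m * n) -> V) :
  \sum_x F x = \sum_i \sum_j F (mxtens_index (i, j)).
Proof.
rewrite pair_bigA (reindex (@mxtens_index m n)) /=.
  by apply: eq_bigr => -[].
by exists (@mxtens_unindex m n) => x _; rewrite (mxtens_indexK, mxtens_unindexK).
Qed.

Lemma tensmx_expand m n (M : 'M[C]_(m * n)) :
  M = \sum_(i < m) \sum_(j < m) \sum_(k < n) \sum_(l < n)
    M (mxtens_index (i, k)) (mxtens_index (j, l))
      *: (delta_mx i j *t delta_mx k l).
Proof.
have deltaE i k j l : delta_mx i j *t delta_mx k l =
    delta_mx (mxtens_index (i, k)) (mxtens_index (j, l)) :> 'M[C]_(m * n).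
  apply/matrixP => x y; case: (mxtens_indexP x) => i1 i2.
  case: (mxtens_indexP y) => j1 j2; rewrite tensmxE !mxE -natrM mulnb.
  rewrite !(can_eq (@mxtens_indexK m n)) !xpair_eqE.
  by congr (_%:R); rewrite andbACA.
rewrite {1}[M]matrix_sum_delta sum_mxtens_index; apply: eq_bigr => i _.
under eq_bigr => k _ do rewrite sum_mxtens_index.
rewrite exchange_big; apply: eq_bigr => j _; apply: eq_bigr => k _.
by apply: eq_bigr => l _; rewrite deltaE.
Qed.

(** Product matrices span, by [tensmx_expand]. Later identities between maps on a composite system
    are reduced to products in this way. *)
Lemma tensmx_ext m n (V : lmodType C) (f g : 'M[C]_(m * n) -> V) :
  linear f -> linear g -> (forall A B, f (A *t B) = g (A *t B)) -> f =1 g.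
Proof.
move=> lf lg fg M; rewrite [M]tensmx_expand.
rewrite (linear_bigsum lf) (linear_bigsum lg); apply: eq_bigr => i _.
rewrite (linear_bigsum lf) (linear_bigsum lg); apply: eq_bigr => j _.
rewrite (linear_bigsum lf) (linear_bigsum lg); apply: eq_bigr => k _.
rewrite (linear_bigsum lf) (linear_bigsum lg); apply: eq_bigr => l _.
by rewrite (linear_Z lf) (linear_Z lg) fg.
Qed.

Lemma tensmap_linear m n (Phi : 'M[C]_m -> 'M[C]_m) (Psi : 'M[C]_n -> 'M[C]_n) :
  linear (tensmap Phi Psi).
Proof.
move=> a u v; rewrite /tensmap.
do 4! [rewrite scaler_sumr -big_split; apply: eq_bigr => ? _ /=].
by rewrite !mxE scalerDl scalerA.
Qed.

Lemma tensmapE m n (Phi : 'M[C]_m -> 'M[C]_m) (Psi : 'M[C]_n -> 'M[C]_n) A B :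
  linear Phi -> linear Psi -> tensmap Phi Psi (A *t B) = Phi A *t Psi B.
Proof.
move=> lPhi lPsi.
have l1 D : linear (fun X => Phi X *t D : 'M[C]_(m * n)).
  exact: (linear_comp (tensmxl_linear D) lPhi).
have l2 D : linear (fun X => D *t Psi X : 'M[C]_(m * n)).
  exact: (linear_comp (tensmxr_linear D) lPsi).
rewrite [A in RHS]matrix_sum_delta (linear_bigsum (l1 _)); apply: eq_bigr => i _.
rewrite (linear_bigsum (l1 _)); apply: eq_bigr => j _.
rewrite (linear_Z (l1 _)) [B in RHS]matrix_sum_delta (linear_bigsum (l2 _)).
rewrite scaler_sumr; apply: eq_bigr => k _.
rewrite (linear_bigsum (l2 _)) scaler_sumr; apply: eq_bigr => l _.
by rewrite (linear_Z (l2 _)) scalerA tensmxE.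
Qed.

Lemma eq_tensmap m n (Phi Phi' : 'M[C]_m -> 'M[C]_m)
    (Psi Psi' : 'M[C]_n -> 'M[C]_n) :
  Phi =1 Phi' -> Psi =1 Psi' -> tensmap Phi Psi =1 tensmap Phi' Psi'.
Proof.
move=> eP eQ M; rewrite /tensmap.
by do 4! [apply: eq_bigr => ? _]; rewrite eP eQ.
Qed.

Lemma tensmap_comp m n (Phi Phi' : 'M[C]_m -> 'M[C]_m)
    (Psi Psi' : 'M[C]_n -> 'M[C]_n) :
  linear Phi -> linear Phi' -> linear Psi -> linear Psi' ->
  tensmap Phi Psi \o tensmap Phi' Psi' =1 tensmap (Phi \o Phi') (Psi \o Psi').
Proof.
move=> l1 l2 l3 l4; apply: tensmx_ext.
- exact: linear_comp (tensmap_linear _ _) (tensmap_linear _ _).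
- exact: tensmap_linear.
by move=> A B /=; rewrite !tensmapE //; exact: linear_comp.
Qed.

Lemma ptrace1_linear m n : linear (@ptrace1 R m n).
Proof.
move=> a u v; apply/matrixP => i j; rewrite !mxE mulr_sumr -big_split.
by apply: eq_bigr => k _; rewrite !mxE.
Qed.

Lemma ptrace1_tens m n (A : 'M[C]_m) (B : 'M[C]_n) :
  ptrace1 (A *t B) = \tr A *: B.
Proof.
apply/matrixP => i j; rewrite !mxE mulr_suml.
by apply: eq_bigr => k _; rewrite tensmxE.
Qed.

(** On [A *t B] both sides are [\tr A *: Psi B]. This makes the channel output the marginal of the
    joint output state. *)
Lemma ptrace1_tensmap m n (Psi : 'M[C]_n -> 'M[C]_n) : linear Psi ->
  @ptrace1 R m n \o tensmap idfun Psi =1 Psi \o @ptrace1 R m n.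
Proof.
move=> lPsi; apply: tensmx_ext.
- exact: linear_comp (@ptrace1_linear m n) (tensmap_linear _ _).
- exact: linear_comp lPsi (@ptrace1_linear m n).
by move=> A B /=; rewrite tensmapE // !ptrace1_tens (linear_Z lPsi).
Qed.

Lemma mulmx_conj_linear n (U V : 'M[C]_n) : linear (fun M => U *m M *m V).
Proof. by move=> a u v; rewrite mulmxDr mulmxDl -scalemxAr -scalemxAl. Qed.

Lemma ptrace1_mulmx m n (U V : 'M[C]_n) (M : 'M[C]_(m * n)) :
  ptrace1 ((1%:M *t U) *m M *m (1%:M *t V)) = U *m ptrace1 M *m V.
Proof.
pose f M := ptrace1 ((1%:M *t U) *m M *m (1%:M *t V) : 'M_(m * n)).
pose g M := U *m @ptrace1 R m n M *m V.
suff : f =1 g by apply.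
apply: tensmx_ext.
- exact: linear_comp (@ptrace1_linear m n) (mulmx_conj_linear _ _).
- exact: linear_comp (mulmx_conj_linear _ _) (@ptrace1_linear m n).
move=> A B; rewrite /f /g !tensmx_mul !ptrace1_tens mul1mx mulmx1.
by rewrite -scalemxAr -scalemxAl.
Qed.

End Tensor.

(** * Mixtures of unitary conjugations: tensor products and positivity *)

Section MixedUnitary.
Variable R : realType.
Local Notation C := R[i].

Lemma conj_sum_linear (I : finType) n (p : I -> R) (U : I -> 'M[C]_n) :
  linear (fun M => \sum_i (p i)%:C *: (U i *m M *m (U i) ^t*)).
Proof.
move=> a u v; rewrite scaler_sumr -big_split; apply: eq_bigr => i _ /=.
by rewrite mulmx_conj_linear scalerDr scalerA mulrC -scalerA.
Qed.

Definition mixed_unitary n (Phi : 'M[C]_n -> 'M[C]_n) :=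
  exists (I : finType) (p : I -> R) (U : I -> 'M[C]_n),
    [/\ forall i, 0 <= p i, \sum_i p i = 1, forall i, U i \is unitarymx
      & forall M, Phi M = \sum_i (p i)%:C *: (U i *m M *m (U i) ^t*)].

Lemma mixed_unitary_linear n (Phi : 'M[C]_n -> 'M[C]_n) :
  mixed_unitary Phi -> linear Phi.
Proof.
by move=> [I [p [U [_ _ _ PhiE]]]] a u v; rewrite !PhiE conj_sum_linear.
Qed.

Lemma mixed_unitary_id n : mixed_unitary (@idfun 'M[C]_n).
Proof.
exists unit, (fun=> 1), (fun=> 1%:M); split=> //.
- by rewrite big_const card_unit /= addr0.
- by move=> _; exact: unitarymx1.
move=> M; rewrite big_const card_unit /= addr0 trmx1 map_mx1 mulmx1 mul1mx.
by rewrite scale1r.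
Qed.

(** Independent choices of the two unitaries, with the product distribution on pairs; the equality
    is checked on product matrices. *)
Lemma mixed_unitary_tens m n (Phi : 'M[C]_m -> 'M[C]_m)
    (Psi : 'M[C]_n -> 'M[C]_n) :
  mixed_unitary Phi -> mixed_unitary Psi -> mixed_unitary (tensmap Phi Psi).
Proof.
move=> mPhi mPsi.
have lPhi := mixed_unitary_linear mPhi; have lPsi := mixed_unitary_linear mPsi.
have [I [p [U [p0 p1 Uu PhiE]]]] := mPhi.
have [J [q [V [q0 q1 Vu PsiE]]]] := mPsi.
exists (I * J)%type, (fun ij => p ij.1 * q ij.2), (fun ij => U ij.1 *t V ij.2).
split=> [ij||ij|].
- by rewrite mulr_ge0.
- rewrite -(pair_bigA _ (fun i j => p i * q j)) /= -p1; apply: eq_bigr => i _.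
  by rewrite -mulr_sumr q1 mulr1.
- exact: tensmx_unitary.
apply: tensmx_ext; [exact: tensmap_linear|exact: conj_sum_linear|].
move=> A B; rewrite tensmapE // PhiE PsiE.
rewrite (linear_bigsum (tensmxl_linear _)).
rewrite -(pair_bigA _ (fun i j => (p i * q j)%:C *:
  (U i *t V j *m (A *t B) *m (U i *t V j) ^t*))) /=.
apply: eq_bigr => i _; rewrite (linear_Z (tensmxl_linear _)).
rewrite (linear_bigsum (tensmxr_linear _)) scaler_sumr; apply: eq_bigr => j _.
rewrite (linear_Z (tensmxr_linear _)) scalerA -rmorphM.
by rewrite tensmx_conj !tensmx_mul.
Qed.

Lemma mixed_unitary_ntens m (Phi : 'M[C]_m -> 'M[C]_m) n :
  mixed_unitary Phi -> mixed_unitary (ntensmap Phi n).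
Proof.
move=> mPhi; case: n => [|n] /=; first exact: mixed_unitary_id.
by elim: n => //= n IH; exact: mixed_unitary_tens.
Qed.

Lemma psd_conj n (U A : 'M[C]_n) : psdmx A -> psdmx (U *m A *m U ^t*).
Proof.
(* The Hermitian predicate carries a sign, here a zeroth power of -1, which [expr0] and [scale1r]
   remove. *)
move=> [/is_hermitianmxP]; rewrite expr0 scale1r => Ah A0; split.
  apply/is_hermitianmxP.
  by rewrite expr0 scale1r !(trmx_mul, map_mxM) /= trmxCK -Ah mulmxA.
move=> v; have := A0 (U ^t* *m v).
by rewrite !(trmx_mul, map_mxM) /= trmxCK !mulmxA.
Qed.

Lemma psd_mixed_unitary n (Phi : 'M[C]_n -> 'M[C]_n) A :
  mixed_unitary Phi -> psdmx A -> psdmx (Phi A).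
Proof.
move=> [I [p [U [p0 _ _ ->]]]] psdA.
apply: (big_ind (@psdmx R n)).
- split; last by move=> v; rewrite mulmx0 mul0mx mxE.
  by apply/is_hermitianmxP; rewrite expr0 scale1r trmx0 map_mx0.
- move=> X Y [/is_hermitianmxP Xh X0] [/is_hermitianmxP Yh Y0].
  rewrite expr0 scale1r in Xh; rewrite expr0 scale1r in Yh; split.
    apply/is_hermitianmxP; rewrite expr0 scale1r linearD /= map_mxD /=.
    by rewrite -Xh -Yh.
  by move=> v; rewrite mulmxDr mulmxDl mxE addr_ge0.
move=> i _; have [/is_hermitianmxP Xh X0] := psd_conj (U i) psdA.
rewrite expr0 scale1r in Xh; split.
  apply/is_hermitianmxP; rewrite expr0 scale1r linearZ /= map_mxZ /=.
  rewrite -Xh; congr (_ *: _).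
  by apply/eqP; rewrite eq_complex /= oppr0 !eqxx.
move=> v; rewrite -scalemxAr -scalemxAl mxE mulr_ge0 //.
by rewrite ler0c.
Qed.

Lemma psd_pure_state n (psi : 'cV[C]_n) : psdmx (pure_state psi).
Proof.
split.
  apply/is_hermitianmxP; rewrite expr0 scale1r /pure_state trmx_mul map_mxM /=.
  by rewrite trmxCK.
move=> v; rewrite /pure_state mulmxA -mulmxA.
(* The quadratic form is the squared modulus of the inner product [a]. *)
set a := v ^t* *m psi; have -> : psi ^t* *m v = a ^t*.
  by rewrite /a trmx_mul map_mxM /= trmxCK.
by rewrite mxE big_ord1 !mxE mul_conjC_ge0.
Qed.

End MixedUnitary.

(** * Coherent information as relative entropy to identity tensor marginal *)

Section Coherent.
Variable R : realType.
Local Notation C := R[i].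
Local Notation Re := (@complex.Re R).

Lemma diagonalizes_tens1 k n (W : 'M[C]_n) m A : diagonalizes W m A ->
  diagonalizes ((1%:M : 'M_k) *t W) (fun x => m (mxtens_unindex x).2)
    ((1%:M : 'M_k) *t A).
Proof.
move=> [Wu m0 ->]; split=> //.
  by apply: tensmx_unitary => //; exact: unitarymx1.
have -> : rdiag (fun x => m (mxtens_unindex x).2) = (1%:M : 'M_k) *t rdiag m.
  apply/matrixP => x y; case: (mxtens_indexP x) => a i.
  case: (mxtens_indexP y) => b j; rewrite tensmxE !mxE mxtens_indexK /=.
  rewrite (can_eq (@mxtens_indexK k n)) xpair_eqE.
  by case: (a == b); case: (i == j); rewrite ?mulr1n ?mulr0n ?(mul0r, mul1r, mulr0).
by rewrite tensmx_conj trmx1 map_mx1 !tensmx_mul !mulmx1.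
Qed.

(** With [K] the overlap matrix, [w] in the basis of [W] is [K ^t* *m rdiag l *m K], whose diagonal
    consists of weighted column sums. *)
Lemma sum_sqnorm_col n (U W : 'M[C]_n) l w j : diagonalizes U l w ->
  \sum_i sqnorm ((U *m W ^t*) i j) * l i = Re ((W *m w *m W ^t*) j j).
Proof.
move=> [_ _ ->]; pose K := U *m W ^t*.
have -> : W *m (U ^t* *m rdiag l *m U) *m W ^t* = K ^t* *m (rdiag l *m K).
  by rewrite /K trmx_mul map_mxM /= trmxCK !mulmxA.
rewrite mxE Re_sum; apply: eq_bigr => i _.
have -> : (rdiag l *m K) i j = (l i)%:C * K i j.
  by rewrite mul_diag_mx mxE [X in X * _]mxE.
have -> : (K ^t*) j i = (K i j)^* by rewrite mxE mxE.
by rewrite mulrCA ReZ [_^* * _]mulrC mulzJ /= mulrC.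
Qed.

Section Bipartite.
Variables (k n : nat) (w : 'M[C]_(k * n)).
Variables (U : 'M[C]_(k * n)) (l : 'I_(k * n) -> R).
Variables (W : 'M[C]_n) (m : 'I_n -> R).
Hypotheses (dw : diagonalizes U l w) (ds : diagonalizes W m (ptrace1 w)).

Let m2 (x : 'I_(k * n)) := m (mxtens_unindex x).2.
Let K := U *m ((1%:M : 'M_k) *t W) ^t*.

(** The inner sum is a diagonal entry of [w] in the basis given by [1%:M *t W]; summing over [a]
    takes the partial trace, which is diagonal in the basis [W]. *)
Lemma sum_overlap_marginal j :
  \sum_(a < k) \sum_i sqnorm (K i (mxtens_index (a, j))) * l i = m j.
Proof.
under eq_bigr => a _ do rewrite (sum_sqnorm_col _ _ dw).
have := diagonalizesE ds => /(congr1 (fun A : 'M_n => Re (A j j))).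
have -> : Re (rdiag m j j) = m j by rewrite !mxE eqxx.
rewrite -ptrace1_mulmx => <-.
rewrite mxE Re_sum; apply: eq_bigr => a _.
by rewrite tensmx_conj trmx1 map_mx1.
Qed.

(** By [sum_overlap_marginal], a zero eigenvalue of the marginal is a sum of nonnegative overlap
    terms, so each of them vanishes. *)
Lemma marginal_supports : supports K l m2.
Proof.
have [_ l0 _] := dw.
move=> i x; case: (mxtens_indexP x) => a j; rewrite /m2 mxtens_indexK /= => mj.
have ge0 b i' : 0 <= sqnorm (K i' (mxtens_index (b, j))) * l i'.
  by rewrite mulr_ge0 ?sqnorm_ge0.
have /eqP := sum_overlap_marginal j.
rewrite mj psumr_eq0; last by move=> b _; apply: sumr_ge0.
move=> /allP /(_ a); rewrite mem_index_enum => /(_ isT) /=.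
rewrite psumr_eq0 // => /allP /(_ i).
by rewrite mem_index_enum => /(_ isT) /eqP.
Qed.

(** Row sums of squared overlaps are 1, which settles the first logarithm; [sum_overlap_marginal]
    settles the second. Up to the factor [ln 2] the value is the entropy of the marginal minus that
    of [w]. *)
Lemma rel_entropy_marginal :
  rel_entropy K l m2 = \sum_i l i * ln (l i) - \sum_j m j * ln (m j).
Proof.
have [Uu _ _] := dw; have [Wu _ _] := diagonalizes_tens1 k ds.
rewrite /rel_entropy.
under eq_bigr => i _ do under eq_bigr => j _ do rewrite mulrBr.
under eq_bigr => i _ do rewrite sumrB.
rewrite sumrB; congr (_ - _).
  apply: eq_bigr => i _; rewrite -mulr_suml -mulr_suml.
  by rewrite (sum_sqnorm_row _ (overlap_unitary Uu Wu)) mul1r.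
rewrite exchange_big sum_mxtens_index exchange_big; apply: eq_bigr => j _ /=.
rewrite -[X in _ = X * _]sum_overlap_marginal mulr_suml; apply: eq_bigr => a _.
rewrite mulr_suml; apply: eq_bigr => i _.
by rewrite /m2 mxtens_indexK.
Qed.

End Bipartite.

(** [mixed_unitary_tens] hides its unitaries under an existential. Here they are explicit, so that
    one and the same mixture can be applied to [w] and to [1%:M *t ptrace1 w]. *)
Lemma tensmap_id_sum (I : finType) k n (p : I -> R) (V : I -> 'M[C]_n)
    (Psi : 'M[C]_n -> 'M[C]_n) (M : 'M[C]_(k * n)) :
  (forall A, Psi A = \sum_i (p i)%:C *: (V i *m A *m (V i) ^t*)) ->
  tensmap idfun Psi M = \sum_i (p i)%:C *:
    ((1%:M *t V i) *m M *m (1%:M *t V i) ^t*).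
Proof.
move=> PsiE; have lPsi : linear Psi.
  by move=> a u v; rewrite !PsiE conj_sum_linear.
move: M; apply: tensmx_ext; [exact: tensmap_linear|exact: conj_sum_linear|].
move=> A B; rewrite tensmapE // PsiE (linear_bigsum (tensmxr_linear _)).
apply: eq_bigr => i _; rewrite (linear_Z (tensmxr_linear _)).
by rewrite tensmx_conj !tensmx_mul trmx1 map_mx1 mul1mx mulmx1.
Qed.

Lemma coherent_mixed_unitary k n (Psi : 'M[C]_n -> 'M[C]_n)
    (w : 'M[C]_(k * n)) :
  mixed_unitary Psi -> psdmx w -> psdmx (ptrace1 w) ->
  vn_entropy (Psi (ptrace1 w)) - vn_entropy (tensmap idfun Psi w) <=
  vn_entropy (ptrace1 w) - vn_entropy w.
Proof.
move=> mPsi psdw psds.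
have lPsi := mixed_unitary_linear mPsi.
have mid := @mixed_unitary_id R k.
set w' := tensmap idfun Psi w.
have sE : Psi (ptrace1 w) = ptrace1 w'.
  by have /= -> := ptrace1_tensmap lPsi w.
have psdw' : psdmx w' by exact: psd_mixed_unitary (mixed_unitary_tens _ _) _.
have psds' : psdmx (ptrace1 w') by rewrite -sE; exact: psd_mixed_unitary.
rewrite sE.
have [U [l [dw ->]]] := psd_diagonalizes psdw.
have [W [m [ds ->]]] := psd_diagonalizes psds.
have [U' [l' [dw' ->]]] := psd_diagonalizes psdw'.
have [W' [m' [ds' ->]]] := psd_diagonalizes psds'.
have log2E (N : nat) (f : 'I_N -> R) :
    \sum_i f i * log2 (f i) = (\sum_i f i * ln (f i)) / ln 2.
  by rewrite mulr_suml; apply: eq_bigr => i _; rewrite mulrA.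
rewrite !log2E !opprK ![- _ + _]addrC -!mulrBl ler_pM2r; last first.
  by rewrite invr_gt0 ln_gt0 // ltr1n.
rewrite -(rel_entropy_marginal dw ds) -(rel_entropy_marginal dw' ds').
have [I [p [V [p0 p1 Vu PsiE]]]] := mPsi.
apply: (@rel_entropy_mixed_unitary _ I _ p (fun i => 1%:M *t V i) w
  (1%:M *t ptrace1 w)) => //.
- by move=> i; apply: tensmx_unitary => //; exact: unitarymx1.
- exact: diagonalizes_tens1.
- by rewrite -(tensmap_id_sum _ PsiE).
(* The mixture sends [1%:M *t ptrace1 w] to [1%:M *t ptrace1 w'], so the mixed pair again consists
   of a state and its marginal. *)
- by rewrite -(tensmap_id_sum _ PsiE) tensmapE // sE; exact: diagonalizes_tens1.
- exact: marginal_supports dw ds.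
- exact: marginal_supports dw' ds'.
Qed.

End Coherent.

(** * The depolarizing semigroup and the conclusion *)

Section Depolarizing.
Variable R : realType.
Local Notation C := R[i].

Lemma mul2mx (A B : 'M[C]_2) i j : (A *m B) i j = A i 0 * B 0 j + A i 1 * B 1 j.
Proof.
rewrite mxE !big_ord_recl big_ord0 addr0; congr (_ + A _ _ * B _ _); exact: val_inj.
Qed.

Lemma ord2P (i : 'I_2) : i = 0 \/ i = 1.
Proof. by case: i => -[|[|//]] ?; [left|right]; exact: val_inj. Qed.

Lemma pauli_twirl (M : 'M[C]_2) :
  pauliX R *m M *m pauliX R + pauliY R *m M *m pauliY R
  + pauliZ R *m M *m pauliZ R = (2 * \tr M)%:M - M.
Proof.
have trE : \tr M = M 0 0 + M 1 1.
  rewrite /mxtrace !big_ord_recl big_ord0 addr0; congr (_ + M _ _); exact: val_inj.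
have ii : 'i * 'i = -1 :> C := sqr_i R.
apply/matrixP => i j.
case: (ord2P i) => ->; case: (ord2P j) => ->.
all: rewrite trE !(mul2mx, mxE) /= ?mulr1n ?mulr0n; ring: ii.
Qed.

Lemma pauli_herm : [/\ (pauliX R) ^t* = pauliX R, (pauliY R) ^t* = pauliY R
  & (pauliZ R) ^t* = pauliZ R].
Proof.
split; apply/matrixP => i j; rewrite !mxE.
all: case: (ord2P i) => ->; case: (ord2P j) => -> /=.
all: apply/eqP; rewrite eq_complex /=; apply/andP; split; apply/eqP; ring.
Qed.

Lemma pauli_unitary : [/\ pauliX R \is unitarymx, pauliY R \is unitarymx
  & pauliZ R \is unitarymx].
Proof.
have [Xh Yh Zh] := pauli_herm.
have ii : 'i * 'i = -1 :> C := sqr_i R.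
split; apply/unitarymxP; rewrite ?Xh ?Yh ?Zh; apply/matrixP => i j.
all: case: (ord2P i) => ->; case: (ord2P j) => ->.
all: rewrite !(mul2mx, mxE) /= ?mulr1n ?mulr0n; ring: ii.
Qed.

Lemma mixed_unitary_depolarizing (p : R) : 0 <= p -> p <= 1 / 4 ->
  mixed_unitary (depolarizing p).
Proof.
move=> p0 p4.
have [Xu Yu Zu] := pauli_unitary; have [Xh Yh Zh] := pauli_herm.
exists 'I_4, (fun i : 'I_4 => nth 0 [:: 1 - 3 * p; p; p; p] i),
  (fun i : 'I_4 => nth 0 [:: 1%:M; pauliX R; pauliY R; pauliZ R] i); split.
- case=> -[|[|[|[|//]]]] //= _; lra.
- rewrite !big_ord_recl big_ord0 /=; ring.
- case=> -[|[|[|[|i]]]] /= lt_i.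
  + exact: unitarymx1.
  + exact: Xu.
  + exact: Yu.
  + exact: Zu.
  + by case: (notF lt_i).
move=> M; rewrite !big_ord_recl big_ord0 /= trmx1 map_mx1 mul1mx mulmx1.
by rewrite Xh Yh Zh addr0 /depolarizing !scalerDr !addrA.
Qed.

(** By [pauli_twirl], the channel is a contraction by [1 - 4 * p] towards the maximally mixed state,
    which makes compositions easy to compute. *)
Lemma depolarizingE (p : R) (M : 'M[C]_2) :
  depolarizing p M = (1 - 4 * p)%:C *: M + (2 * p%:C * \tr M)%:M.
Proof.
rewrite /depolarizing pauli_twirl scalerBr addrCA addrC scale_scalar_mx -scalerBl.
congr (_ *: _ + _%:M); last by ring.
by apply/eqP; rewrite eq_complex /=; apply/andP; split; apply/eqP; ring.
Qed.

(** Contraction factors multiply: [(1 - 4 * p) * (1 - 4 * q) = 1 - 4 * (p + q - 4 * p * q)]. *)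
Lemma depolarizing_comp (p q : R) (M : 'M[C]_2) :
  depolarizing q (depolarizing p M) = depolarizing (p + q - 4 * p * q) M.
Proof.
rewrite !depolarizingE.
have -> : \tr ((1 - 4 * p)%:C *: M + (2 * p%:C * \tr M)%:M) = \tr M.
  rewrite mxtraceD mxtraceZ mxtrace_scalar.
  rewrite !(rmorphB, rmorphM, rmorph1, rmorph_nat) /=.
  ring.
rewrite scalerDr scalerA scale_scalar_mx -addrA -raddfD /=.
congr (_ *: _ + _%:M);
  rewrite !(rmorphD, rmorphB, rmorphM, rmorph1, rmorph_nat) /=; ring.
Qed.

Lemma ntens_depolarizing_comp n (p q : R) :
  0 <= p <= 1 / 4 -> 0 <= q <= 1 / 4 ->
  ntensmap (depolarizing q) n \o ntensmap (depolarizing p) n =1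
  ntensmap (depolarizing (p + q - 4 * p * q)) n.
Proof.
move=> /andP[p0 p4] /andP[q0 q4].
have mp := mixed_unitary_depolarizing p0 p4.
have mq := mixed_unitary_depolarizing q0 q4.
have lin N Phi : @mixed_unitary R N Phi -> linear Phi.
  exact: mixed_unitary_linear.
case: n => [|n] //; elim: n => [|n IH] M; first exact: depolarizing_comp.
have mpn := mixed_unitary_ntens n.+1 mp; have mqn := mixed_unitary_ntens n.+1 mq.
rewrite (tensmap_comp (lin _ _ mq) (lin _ _ mp) (lin _ _ mqn) (lin _ _ mpn)).
exact: (eq_tensmap (depolarizing_comp p q) IH).
Qed.

Lemma coherent_info_nonincreasing n (rho : 'M[C]_(2 ^ n)) (k : nat)
    (psi : 'cV[C]_(k * 2 ^ n)) : density rho -> purifies psi rho ->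
  {in `[0, 1 / 4] &, nonincreasing_fun (fun p : R =>
     coherent_info rho psi (ntensmap (depolarizing p) n))}.
Proof.
move=> [psd_rho _] rhoE p p'.
rewrite !in_itv /= => /andP[p0 p4] /andP[p'0 p'4] pp'.
(* At [p = 1 / 4] the contraction factor is 0 and cannot be divided by, but then [p' = p]. *)
have [pE|pN] := eqVneq p (1 / 4).
  by have -> : p' = p by apply/eqP; rewrite eq_le pp' pE p'4.
have plt : 0 < 1 - 4 * p by move: pN; rewrite neq_lt => /orP[]; lra.
(* The solution of [1 - 4 * p' = (1 - 4 * p) * (1 - 4 * q)]; [q <= 1 / 4] amounts to
   [p' <= 1 / 4]. *)
pose q := (p' - p) / (1 - 4 * p).
have q0 : 0 <= q by apply: divr_ge0; [rewrite subr_ge0|exact: ltW].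
have q4 : q <= 1 / 4 by rewrite ler_pdivrMr //; lra.
have p'E : p' = p + q - 4 * p * q by rewrite /q; field; rewrite gt_eqF.
have mp := mixed_unitary_ntens n (mixed_unitary_depolarizing p0 p4).
have mq := mixed_unitary_ntens n (mixed_unitary_depolarizing q0 q4).
have lp := mixed_unitary_linear mp; have lq := mixed_unitary_linear mq.
have comp : ntensmap (depolarizing q) n \o ntensmap (depolarizing p) n =1
    ntensmap (depolarizing p') n.
  by rewrite p'E; apply: ntens_depolarizing_comp; rewrite ?p0 ?q0.
pose w := tensmap idfun (ntensmap (depolarizing p) n) (pure_state psi).
have lid : linear (@idfun 'M[C]_k) by [].
have wE : tensmap idfun (ntensmap (depolarizing p') n) (pure_state psi) =
    tensmap idfun (ntensmap (depolarizing q) n) w.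
  rewrite -(eq_tensmap (fun=> erefl) comp).
  exact: esym (tensmap_comp lid lid lq lp _).
have sE : ntensmap (depolarizing p) n rho = ptrace1 w.
  by have /= -> := ptrace1_tensmap lp (pure_state psi); rewrite rhoE.
have psdw : psdmx w.
  apply: psd_mixed_unitary (psd_pure_state psi).
  exact: mixed_unitary_tens (mixed_unitary_id _ _) mp.
have rE : ntensmap (depolarizing p') n rho =
    ntensmap (depolarizing q) n (ptrace1 w) by rewrite -sE; exact: esym (comp _).
have psds : psdmx (ptrace1 w) by rewrite -sE; exact: psd_mixed_unitary psd_rho.
rewrite /coherent_info wE rE sE.
exact: coherent_mixed_unitary mq psdw psds.
Qed.

End Depolarizing.

Theorem lemma3 (R : realType) (rho : 'M[R[i]]_(2 ^ 45)) (k : nat)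
    (psi : 'cV[R[i]]_(k * 2 ^ 45)) (hrho : density rho)
    (hpsi : purifies psi rho) :
  {in `[0, 1 / 4] &, nonincreasing_fun (fun p : R =>
     coherent_info rho psi (ntensmap (depolarizing p) 45))}.
Proof. exact: coherent_info_nonincreasing hrho hpsi. Qed.
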